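(* Let $X$ be a Hausdorff space with a countable $k$-network (for example, an $\aleph_0$-space, that is, a regular space with a countable $k$-network), and let $\mathcal I$ be a discretely-complete ideal of compact subsets of $X$. If a topological space $Y$ has the strong Pytkeev$^*$ property at a point $y\in Y$, then the function space $C_{\mathcal I}(X,Y)$ has the strong Pytkeev$^*$ property at the constant function $\bar y:X\to\{y\}\subset Y$.
   Context: A sequence $(x_n)_{n\in\omega}$ in a topological space $Z$ accumulates at $z\in Z$ if each neighborhood of $z$ contains $x_n$ for infinitely many indices $n\in\omega$. A family $\mathcal N$ of subsets of $Z$ is a Pytkeev$^*$ network at $z\in Z$ if for each neighborhood $O_z$ of $z$ and each sequence $(x_n)_{n\in\omega}\in Z^\omega$ accumulating at $z$ there is $N\in\mathcal N$ such that $z\in N\subset O_z$ and $N$ contains $x_n$ for infinitely many $n$. The space $Z$ has the strong Pytkeev$^*$ property at $z$ if $Z$ has a countable (i.e. at most countable) Pytkeev$^*$ network at $z$. A family $\mathcal N$ of subsets of $X$ is a $k$-network if for any open $U\subset X$ and compact $K\subset U$ there is a finite subfamily $\mathcal F\subset\mathcal N$ with $K\subset\bigcup\mathcal F\subset U$. A family $\mathcal I$ of compact subsets of $X$ is an ideal of compact sets if $\bigcup\mathcal I=X$ and for any $A,B\in\mathcal I$ and any compact $K\subset X$ we have $A\cup B\in\mathcal I$ and $A\cap K\in\mathcal I$. It is discretely-complete if for any compact subsets $A,B\subset X$ such that $A\setminus B$ is a countable discrete subspace of $X$, the inclusion $B\in\mathcal I$ implies $A\in\mathcal I$. $C_{\mathcal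 I}(X,Y)$ is the set of all continuous functions $X\to Y$ with the topology generated by the subbase of sets $[K;U]=\{f: f(K)\subset U\}$, where $K\in\mathcal I$ and $U\subset Y$ is open. *)

(* Defs.v *)
From HB Require Import structures.
From mathcomp Require Import all_boot all_classical topology.

Set Implicit Arguments.
Unset Strict Implicit.
Unset Printing Implicit Defensive.

Local Open Scope classical_set_scope.

(* [countable] is the library's "at most countable" throughout. *)

Section pytkeev.
Context {Z : topologicalType}.

(* The sequence [x] accumulates at [z]. *)
Definition infinitely_often_near (x : nat -> Z) (z : Z) : Prop :=
  forall O : set Z, nbhs z O -> infinite_set [set n | O (x n)].

Definition pytkeev_star_network (N : set (set Z)) (z : Z) : Prop :=
  forall (O : set Z) (x : nat -> Z), nbhs z O -> infinitely_often_near x z ->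
    exists A : set Z,
      [/\ N A, A z, A `<=` O & infinite_set [set n | A (x n)]].

Definition strong_pytkeev_star_at (z : Z) : Prop :=
  exists2 N : set (set Z), countable N & pytkeev_star_network N z.

End pytkeev.

Arguments strong_pytkeev_star_at : clear implicits.

Section compact_families.
Context {X : topologicalType}.

Definition k_network (N : set (set X)) : Prop :=
  forall U K : set X, open U -> compact K -> K `<=` U ->
    exists F : set (set X),
      [/\ finite_set F, F `<=` N,
          K `<=` \bigcup_(A in F) A & \bigcup_(A in F) A `<=` U].

Definition compact_ideal (I : set (set X)) : Prop :=
  [/\ I `<=` compact,
      \bigcup_(K in I) K = [set: X],
      forall A B, I A -> I B -> I (A `|` B) &
      forall A K, I A -> compact K -> I (A `&` K)].

(* [S] ranges over the subsets of the type [set_type D], which carries the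
   subspace topology. *)
Definition discrete_subspace (D : set X) : Prop :=
  forall S : set (set_type D), open S.

Definition discretely_complete (I : set (set X)) : Prop :=
  forall A B : set X, compact A -> compact B ->
    countable (A `\` B) -> discrete_subspace (A `\` B) -> I B -> I A.

End compact_families.

Section function_space.
Context {X Y : topologicalType}.

(* The type of continuous functions, indexed by [I] so that each family of
   sets gives it its own topology. *)
Definition set_open_space (I : set (set X)) : Type := continuousType X Y.

Variable I : set (set X).

Definition set_open_subbase (KU : set X * set Y) : set (set_open_space I) :=
  [set f | (f : continuousType X Y) @` KU.1 `<=` KU.2].

HB.instance Definition _ := Choice.copy (set_open_space I) (continuousType X Y).

HB.instance Definition _ := isSubBaseTopological.Build (set_open_space I)
  [set KU : set X * set Y | I KU.1 /\ open KU.2] set_open_subbase.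

End function_space.

Arguments set_open_space {X} Y I.

(* Main.v *)
Require Import Defs.
From mathcomp Require Import all_boot all_classical topology.

Local Open Scope classical_set_scope.

(** The network at the constant function consists of the boxes
    [B; C] = {f | f(B) is contained in C}, where B runs through the finite
    intersections of finite unions of members of a countable k-network of X,
    and C through the sets {y} + (finite union of members of a countable
    Pytkeev* network at y).  There are countably many boxes.

    A neighborhood of the constant function contains some [K; U] with K
    compact, U a neighborhood of y and, unless X is empty, K in the ideal.  The B's containing K provide a descending
    sequence A_k that enters every open set around K
    ([k_network_descending]); the C's inside U provide an ascending sequence
    Q_k that catches infinitely many terms of every sequence accumulating at y
    ([pytkeev_star_network_ascending]).  Then [A_k; Q_k] is contained in [K; U]
    for all k, and it remains to find k such that [A_k; Q_k] contains f_n for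
    infinitely many n, where f_n is the given sequence accumulating at the
    constant function.

    Suppose that there is no such k.  For each k and almost all n there is a
    point of A_k that f_n sends outside Q_k, and by diagonalization
    ([diagonal_choice]) one sequence x_n serves every k, for almost all n.
    Every open set around K contains almost all x_n, so K + {x_n} is compact
    ([compact_setU_range]), and since X is Hausdorff, {x_n} - K is discrete
    ([discrete_range_setD]).  Discrete completeness puts K + {x_n} in the ideal.
    Hence f_n maps K + {x_n} into any given neighborhood of y for infinitely
    many n, which shows that the sequence f_n(x_n) accumulates at y.  So some
    Q_k contains f_n(x_n) for infinitely many n, against the choice of x_n. *)

(** * Countable families and cofinite sets of indices *)

(** An inclusion instead of an equality, so that the empty set is covered. *)
Lemma countable_sub_range {T : pointedType} (A : set T) :
  countable A -> exists e : nat -> T, A `<=` range e.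
Proof.
move=> /countable_injP[f f_inj].
exists (fun n => xget point [set a | A a /\ f a = n]) => a Aa.
exists (f a) => //.
have [Ab fb] : [set b | A b /\ f b = f a] (xget point [set b | A b /\ f b = f a]).
  by apply: (xgetPex point); exists a.
by apply: f_inj => //; exact: mem_set.
Qed.

Lemma countable_image_finite_subsets {T U : Type} (op : set T -> U)
    (D : set T) :
  countable D -> countable [set op F | F in [set F | F `<=` D /\ finite_set F]].
Proof.
by move=> /countable_finite_subset; exact/sub_countable/card_image_le.
Qed.

Lemma near_infty_cofinite (A : set nat) :
  finite_set (~` A) <-> \forall n \near \oo, A n.
Proof.
split=> [/finite_seqP[s sE]|[N _ NA]].
  exists (\max_(i <- s) i).+1 => // n /= sn; apply: contrapT => nA.
  have : (~` A) n by [].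
  rewrite sE /= => ns; move: sn; rewrite ltnNge.
  by rewrite (@leq_bigmax_seq _ s xpredT id n).
apply: (sub_finite_set _ (finite_II N)) => n nA /=.
by rewrite ltnNge; apply/negP => /NA.
Qed.

Lemma infinite_near_infty (A B : set nat) :
  infinite_set A -> (\forall n \near \oo, A n -> B n) -> infinite_set B.
Proof.
move=> Ainf /near_infty_cofinite fin Bfin; apply: Ainf.
apply: (sub_finite_set (B := ~` [set n | A n -> B n] `|` B)).
  by move=> n An; have [Bn|nBn] := pselect (B n); [right|left=> /(_ An)].
by rewrite finite_setU.
Qed.

(** For a given n, a point of [B k n] with the largest possible k <= n lies in
    all the nonempty [B j n] with j <= n. *)
Lemma diagonal_choice {T : Type} (B : nat -> nat -> set T) :
  (forall n j k, j <= k -> B k n `<=` B j n) ->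
  (forall k, \forall n \near \oo, B k n !=set0) ->
  exists x : nat -> T, forall k, \forall n \near \oo, B k n (x n).
Proof.
move=> Banti Bne.
have [_ [t0 _]] := filter_ex (Bne 0).
suff /choice[x xB] : forall n, exists x, forall k, k <= n ->
    B k n !=set0 -> B k n x.
  exists x => k; apply: filter_app (Bne k).
  by exists k => // n /= kn; exact: xB.
(* An induction on the bound [m] on the indices replaces the maximum. *)
move=> n; suff : forall m, exists x, forall k, k <= m ->
  B k n !=set0 -> B k n x by exact.
elim=> [|m [x xB]].
  have [[x Bx]|nB] := pselect (B 0 n !=set0).
    by exists x => k; rewrite leqn0 => /eqP ->.
  by exists t0 => k; rewrite leqn0 => /eqP ->.
have [[z Bz]|nB] := pselect (B m.+1 n !=set0).
  by exists z => k km _; exact: Banti Bz.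
exists x => k; rewrite leq_eqVlt => /predU1P[-> //|]; exact: xB.
Qed.

(** * Sequences converging to a compact set *)

Definition cvg_to_set {X : topologicalType} (x : nat -> X) (K : set X) :=
  forall U : set X, open U -> K `<=` U -> \forall n \near \oo, U (x n).

(** Each point of [K] has a neighborhood that misses some member of [F]; by
    compactness one member of [F] works near all points of [K].  For [F] the
    neighborhoods of a point outside [K], this is the separation of the point
    from [K]. *)
Lemma compact_not_cluster {X : topologicalType} (K : set X) (F : set_system X) :
  ProperFilter F -> compact K -> (forall z, K z -> ~ cluster F z) ->
  exists U : set X, [/\ open U, K `<=` U & F (~` U)].
Proof.
move=> FF cK ncl.
have [W FW KW] : exists2 W, F W & K `<=` (~` W)°.
  have : \forall W \near powerset_filter_from F, K `<=` (~` W)°.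
    move/compact_near_coveringP: cK; apply => z Kz.
    have /existsNP[W /existsNP[V /not_implyP[FW /not_implyP[zV WV0]]]] :=
      ncl z Kz.
    have zV' : \forall z' \near z, nbhs z' V by exact: nbhs_interior.
    near=> z' W' => /=.
    have W'W : W' `<=` W by exact: (near (small_set_sub FW) W').
    apply: filterS (near zV' z' _) => //.
    by move=> v Vv /W'W Wv; apply: WV0; exists v.
  by case=> G [GF _ [W GW]] /(_ W GW) KW; exists W => //; exact: GF.
exists (~` W)°; split=> //; first exact: open_interior.
by apply: filterS FW => w Ww /interior_subset.
Unshelve. all: end_near. Qed.

(** A filter on the union that does not cluster in [K] lives outside an open
    set around [K], thus on finitely many terms of the sequence. *)
Lemma compact_setU_range (X : topologicalType) (K : set X) (x : nat -> X) :
  compact K -> cvg_to_set x K -> compact (K `|` range x).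
Proof.
move=> cK xK F PF FA; apply: contrapT => ncl.
have [|U [oU KU FU]] := compact_not_cluster K F _ cK.
  by move=> z Kz Fz; apply: ncl; exists z; split => //; left.
have [N _ NU] := xK U oU KU.
have FxN : F (x @` `I_N).
  apply: filterS (filterI FA FU) => z [[/KU //|[n _ <-]] nUx].
  by exists n => //=; rewrite ltnNge; apply/negP => /NU.
have /finite_compact cxN : finite_set (x @` `I_N) by exact: finite_image.
have [z [[n _ <-] Fz]] := cxN F PF FxN.
by apply: ncl; exists (x n); split => //; right; exists n.
Qed.

(** A point outside [K] has a neighborhood that misses an open set around [K];
    this neighborhood contains only finitely many terms of the sequence, and in
    a Hausdorff space the terms that differ from the point can be removed. *)
Lemma discrete_range_setD (X : topologicalType) (K : set X) (x : nat -> X) :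
  hausdorff_space X -> compact K -> cvg_to_set x K ->
  discrete_subspace ((K `|` range x) `\` K).
Proof.
move=> hX cK xK; set D := _ `\` K => S.
rewrite openE => d Sd.
have [_ ndK] : D (val d) by apply: set_valP.
have [|U [oU KU dU]] := compact_not_cluster K (nbhs (val d)) _ cK.
  by move=> z Kz /hX dz; apply: ndK; rewrite dz.
have [N _ NU] := xK U oU KU.
(* the terms to be removed *)
pose E := x @` `I_N `\ val d.
have clE : closed E.
  have /accessible_finite_set_closed : accessible_space X.
    exact: hausdorff_accessible.
  by apply; exact/finite_setD/finite_image.
have dE : nbhs (val d) (~` E).
  by apply: open_nbhs_nbhs; split; [exact: closed_openC|case=> _ /(_ erefl)].
have : nbhs d (set_val @^-1` (~` U `&` ~` E)).
  by apply: initial_continuous; apply: filterI.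
apply: filterS => d' [nUd' nEd'].
suff -> : d' = d by [].
apply: val_inj; apply: contrapT => dd'; apply: nEd'; split=> //.
have [[Kd'|[n _ xn]] nKd'] : D (val d') by apply: set_valP.
  by case: nKd'.
by exists n => //=; rewrite ltnNge; apply/negP => /NU; rewrite xn.
Qed.

(** * Monotone sequences extracted from networks *)

(** Given [K], list the finite unions of members of [N] that contain [K] and
    intersect the first k of them.  By the definition of a k-network, every
    open set around [K] contains one of the listed unions. *)
Lemma k_network_descending {X : topologicalType} (N : set (set X)) :
  countable N -> k_network N ->
  exists2 D : set (set X), countable D &
    forall K, compact K -> exists A : nat -> set X,
      [/\ forall k, D (A k), forall k, K `<=` A k,
          forall j k, j <= k -> A k `<=` A j &
          forall U, open U -> K `<=` U -> exists k, A k `<=` U].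
Proof.
move=> cN kN.
pose bigU := fun F : set (set X) => \bigcup_(B in F) B.
pose bigI := fun F : set (set X) => \bigcap_(B in F) B.
pose N' := [set bigU F | F in [set F | F `<=` N /\ finite_set F]].
exists [set bigI F | F in [set F | F `<=` N' /\ finite_set F]].
  by do 2 apply: countable_image_finite_subsets.
move=> K cK.
have [|e eN] := countable_sub_range (N' `&` [set B | K `<=` B]).
  apply: sub_countable (countable_image_finite_subsets bigU N cN).
  by apply: subset_card_le => B [].
pose A k := bigI (e @` `I_k `&` (N' `&` [set B | K `<=` B])).
exists A; split.
- move=> k; exists (e @` `I_k `&` (N' `&` [set B | K `<=` B])) => //.
  split; first by move=> B [_ []].
  exact/finite_setIl/finite_image.
- by move=> k z Kz B [_ [_]]; exact.
- move=> j k jk z Az B [[i ij <-] Ne]; apply: Az; split=> //.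
  by exists i => //=; exact: leq_trans jk.
- move=> U oU KU; have [F [finF FN KF FU]] := kN U K oU cK KU.
  have NF : (N' `&` [set B | K `<=` B]) (bigU F) by split=> //; exists F.
  have [i _ eF] := eN _ NF.
  exists i.+1 => z Az; apply: FU; apply: (Az (bigU F)); split=> //.
  by exists i => //=.
Qed.

(** Given [U], list the members of [P] contained in [U] and unite the first k
    of them.  The point [y] is added because the first few unions may be empty
    or miss it.  A member of [P] that catches infinitely many terms of a
    sequence lies in all the unions from some k on. *)
Lemma pytkeev_star_network_ascending {Y : topologicalType} (P : set (set Y))
    (y : Y) :
  countable P -> pytkeev_star_network P y ->
  exists2 E : set (set Y), countable E &
    forall U, nbhs y U -> exists Q : nat -> set Y,
      [/\ forall k, E (Q k), forall k, Q k y /\ Q k `<=` U,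
          forall j k, j <= k -> Q j `<=` Q k &
          forall z, infinitely_often_near z y ->
            exists k, infinite_set [set n | Q k (z n)]].
Proof.
move=> cP Py.
pose bigU := fun F : set (set Y) => y |` \bigcup_(B in F) B.
exists [set bigU F | F in [set F | F `<=` P /\ finite_set F]].
  exact: countable_image_finite_subsets.
move=> U yU.
have [|e eP] := countable_sub_range (P `&` [set B | B `<=` U]).
  by apply: sub_countable cP; apply: subset_card_le => B [].
pose Q k := bigU (e @` `I_k `&` (P `&` [set B | B `<=` U])).
exists Q; split.
- move=> k; exists (e @` `I_k `&` (P `&` [set B | B `<=` U])) => //.
  split; first by move=> B [_ []].
  exact/finite_setIl/finite_image.
- move=> k; split; first by left.
  by move=> z [->|[B [_ [_ BU]] /BU //]]; exact: nbhs_singleton.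
- move=> j k jk z [zy|[B [[i ij eB] PB] Bz]]; [by left|right].
  by exists B => //; split=> //; exists i => //=; exact: leq_trans jk.
- move=> z zy; have [B [PB _ BU Binf]] := Py U z yU zy.
  have [i _ eB] := eP B (conj PB BU).
  exists i.+1; apply: sub_infinite_set Binf => n Bz; right.
  by exists B => //; split=> //; exists i => //=.
Qed.

(** * Neighborhoods in the function space *)

Lemma open_set_open_subbase (X Y : topologicalType) (I : set (set X)) K U :
  I K -> open U -> open (@set_open_subbase X Y I (K, U)).
Proof.
move=> IK oU.
exists [set @set_open_subbase X Y I (K, U)]; last by rewrite bigcup_set1.
by move=> _ ->; exact: (@finI_from1 _ _ _ _ (K, U)).
Qed.

(** Finitely many subbasic sets [Ki; Ui] around the constant function contain
    [K; U], where K is the union of the Ki and U the intersection of the Ui.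
    When X is empty, the ideal may be empty too, hence the premise [X]: a point
    is needed for the empty union of no Ki to be in the ideal. *)
Lemma nbhs_cst_set_open {X Y : topologicalType} (I : set (set X)) (y : Y)
    (O : set (set_open_space Y I)) :
  compact_ideal I ->
  nbhs ((cst y : continuousType X Y) : set_open_space Y I) O ->
  exists K U, [/\ compact K, X -> I K, nbhs y U &
    [set f : set_open_space Y I | (f : continuousType X Y) @` K `<=` U] `<=` O].
Proof.
move=> [Icpt Icov IU II].
case=> [_ [[B sB <-] [V BV Vy]] sVO].
have [L LI LV] := sB V BV.
suff [K [U [cK IK yU KUV]]] : exists K U, [/\ compact K, X -> I K, nbhs y U &
    [set f : set_open_space Y I | (f : continuousType X Y) @` K `<=` U] `<=` V].
  exists K, U; split=> // f fKU; apply: sVO; exists V => //; exact: KUV.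
have {B sB BV O sVO} : exists s : seq (set X * set Y),
  V = \bigcap_(i in [set` s]) @set_open_subbase X Y I i /\
  forall i, i \in s -> I i.1 /\ open i.2.
  exists (finmap.enum_fset L); split; first by rewrite -LV.
  by move=> i /LI /set_mem.
case=> s [VE sI]; rewrite VE in Vy *; clear L LI LV V VE.
have {}Vy : forall i, i \in s -> (cst y : X -> Y) @` i.1 `<=` i.2 by exact: Vy.
elim: s sI Vy => [|[K0 U0] s IHs] sI Vy.
  exists set0, setT; split=> //; first exact: compact0.
  - move=> x; have : (\bigcup_(K in I) K) x by rewrite Icov.
    by case=> K IK _; rewrite -(setI0 K); apply: II IK (@compact0 _).
  - exact: filterT.
have [||K [U [cK IK yU KUs]]] := IHs.
- by move=> i si; apply: sI; rewrite inE si orbT.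
- by move=> i si; apply: Vy; rewrite inE si orbT.
have [/= IK0 oU0] := sI _ (mem_head _ _).
have /= K0U0 := Vy _ (mem_head _ _).
(* If [K0] is empty, [U0] need not contain [y], and the constraint is void. *)
have [K00|/set0P/negP/negPn/eqP K00] := pselect (K0 !=set0); last first.
  exists K, U; split=> // f fKU i /=; rewrite inE => /predU1P[->|/KUs]; last exact.
  by rewrite /set_open_subbase /= K00 image_set0.
exists (K `|` K0), (U `&` U0); split.
- exact: compactU cK (Icpt _ IK0).
- by move=> x; exact: IU (IK x) IK0.
- apply: filterI => //; apply: open_nbhs_nbhs; split=> //.
  by case: K00 => x K0x; apply: K0U0; exists x.
- move=> f fKU i /=; rewrite inE => /predU1P[->|si].
    by move=> _ [x K0x <-]; have [] := fKU (f x); first by exists x => //; right.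
  apply: (KUs f) => // _ [x Kx <-].
  by have [] := fKU (f x); first by exists x => //; left.
Qed.

(** * The strong Pytkeev* property at constant functions *)

Theorem theorem6p1 (X Y : topologicalType) (I : set (set X)) (y : Y) :
  hausdorff_space X ->
  (exists2 N : set (set X), countable N & k_network N) ->
  compact_ideal I ->
  discretely_complete I ->
  strong_pytkeev_star_at Y y ->
  strong_pytkeev_star_at (set_open_space Y I) (cst y : continuousType X Y).
Proof.
move=> hX [N cN kN] II Idc [P cP Py].
have [D cD DP] := k_network_descending N cN kN.
have [E cE EP] := pytkeev_star_network_ascending P y cP Py.
pose box (BC : set X * set Y) := [set f : set_open_space Y I |
  (f : continuousType X Y) @` BC.1 `<=` BC.2].
exists [set box BC | BC in D `*` E].
  exact: sub_countable (card_image_le _ _) (countableX cD cE).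
move=> O f nO fy.
have [K [U [cK IK yU KUO]]] := nbhs_cst_set_open I y O II nO.
have [A [DA KA Adesc Aout]] := DP K cK.
have [Q [EQ yQU Qasc Qpyt]] := EP U yU.
suff [k kinf] : exists k, infinite_set [set n | box (A k, Q k) (f n)].
  exists (box (A k, Q k)); split=> //.
  - exists (A k, Q k) => //; exact: (conj (DA k) (EQ k)).
  - by move=> _ [x _ <-]; have [] := yQU k.
  - move=> g gAQ; apply: KUO => _ [x Kx <-].
    by have [_] := yQU k; apply; apply: gAQ; exists x => //; exact: KA.
apply: contrapT => nbox.
(* the points of [A k] witnessing that [f n] is not in the box [A k; Q k] *)
pose bad k n := [set x | A k x /\ ~ Q k ((f n : continuousType X Y) x)].
have [n j k jk x [Akx nQk]|k|x xbad] := diagonal_choice bad.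
- by split; [exact: Adesc Akx|move=> Qj; apply: nQk; exact: Qasc jk _ Qj].
- apply/near_infty_cofinite; apply: contrapT => badinf; apply: nbox; exists k.
  apply: sub_infinite_set badinf => n nbad _ [x Ax <-].
  by apply: contrapT => nQ; apply: nbad; exists x.
have xK : cvg_to_set x K.
  move=> V oV KV; have [k AV] := Aout V oV KV.
  by apply: filterS (xbad k) => n [/AV].
have IKx : I (K `|` range x).
  apply: Idc (IK (x 0)) => //.
  - exact: compact_setU_range.
  - apply: (sub_countable (subset_card_le (B := range x) _)) => [z [[]]//|].
    exact: sub_countable (card_image_le _ _) (countableP _).
  - exact: discrete_range_setD.
have [V yV|k kinf] := Qpyt (fun n => (f n : continuousType X Y) (x n)).
  move: yV; rewrite nbhsE => -[W [oW Wy] WV].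
  apply: (sub_infinite_set _ (fy [set g : set_open_space Y I |
    (g : continuousType X Y) @` (K `|` range x) `<=` W] _)).
    by move=> n fW; apply/WV/fW; exists (x n) => //; right; exists n.
  apply: open_nbhs_nbhs; split; first exact: open_set_open_subbase.
  by move=> _ [z _ <-].
apply: (infinite_near_infty _ set0 kinf) => //.
by apply: filterS (xbad k) => n [].
Qed.
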